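(* Let $G$ be an embedded graph and $e\in E(G)$. Then (1) $P(G;\lambda)=P(G/e;\lambda)-P(G^{\tau(e)}/e;\lambda)$; (2) $P(G;\lambda)=P(G/e;\lambda)-P(G^{\tau\delta(e)}/e;\lambda)$; (3) $P(G^{\delta\tau(e)};\lambda)=P(G-e;\lambda)-P(G/e;\lambda)$.
   Context: An embedded graph is a graph cellularly embedded in a closed (possibly non-orientable) surface, up to homeomorphism; equivalently a ribbon graph, encoded by an arrow presentation: one circle per vertex carrying disjoint arrows, each edge label appearing on exactly two arrows (the attaching arcs of that edge, oriented consistently with an orientation of the edge disc); equivalent up to reversing both arrows of a label and relabelling. For an edge $e$: $G^{\tau(e)}$ is obtained by reversing exactly one of the two arrows labelled $e$ (half-twist). $G^{\delta(e)}$ (partial dual): if $A,B$ are the arrows labelled $e$, draw a segment with an arrow from the head of $A$ to the tail of $B$ and one from the head of $B$ to the tail of $A$, label both $e$, and delete $A$ and $B$ with the arcs containing them, the segments becoming arcs of new circles. Composite operations act right to left: $G^{\delta\tau(e)}:=(G^{\tau(e)})^{\delta(e)}$, $G^{\tau\delta(e)}:=(G^{\delta(e)})^{\tau(e)}$. $G-e$ is deletion of the edge $e$, and contraction of any edge (loop or not) is defined by $H/e:=H^{\delta(e)}-e$; thus $G^{\tau(e)}/e=(G^{\tau(e)})^{\delta(e)}-e$ and $G^{\tau\delta(e)}/e=((G^{\delta(e)})^{\tau(e)})^{\delta(e)}-e$. Penrose polynomial: the medial graph $G_m$ has a degree-4 vertex $v_e$ on each edge $e$ of $G$, with edges following face boundaries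 of $G$ (an isolated vertex contributes a vertex-free closed curve); faces of $G_m$ containing a vertex of $G$ are black, others white. At $v_e$, the white split pairs consecutive half-edges bounding white corners, the black split those bounding black corners, the crossing pairs opposite half-edges. A state $s$ chooses a vertex state at each vertex; $c(s)$ = number of resulting closed curves, $cr(s)$ = number of crossings; Penrose states have no black splits; $P(G;\lambda)=\sum_{s\text{ Penrose}}(-1)^{cr(s)}\lambda^{c(s)}$. *)

(* Defs.v *)
From HB Require Import structures.
From mathcomp Require Import all_boot all_order all_algebra.

Set Implicit Arguments.
Unset Strict Implicit.
Unset Printing Implicit Defensive.

Import GRing.Theory.
Local Open Scope ring_scope.

(** * Arrow presentations *)

(** The arrows labelled [e] are [(e, false)] and [(e, true)]; the endpoints of
    the arrow [(e, i)] are its tail [(e, i, false)] and its head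
    [(e, i, true)]. *)
Definition endpoint (E : Type) : Type := (E * bool * bool)%type.

Section Endpoints.
Variable E : Type.
Implicit Type p : endpoint E.

Definition label p : E := p.1.1.

Definition other_end p : endpoint E := (p.1.1, p.1.2, ~~ p.2).

End Endpoints.

(** On a circle that carries an arrow, the arrows alternate with gaps (the
    components of the complement of the arrows), and each gap joins two distinct
    arrow endpoints.  The circles carrying arrows are thus the cycles obtained by
    following alternately arrows and gaps, and are determined by [gap].  The
    circles without arrows (isolated vertices) are only counted, by [bare]. *)
Record arrow_presentation (E : finType) := ArrowPresentation {
  gap : endpoint E -> endpoint E;
  gapK : involutive gap;
  gap_neq : forall p, gap p != p;
  bare : nat
}.

Section Operations.
Variable E : finType.
Implicit Types (G : arrow_presentation E) (e : E) (p q : endpoint E).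

(** Redrawing the arrows on the endpoints of [G], keeping the gaps: the endpoint
    named [p] in the result is the endpoint named [old p] in [G]. *)
Section Redraw.
Variables (G : arrow_presentation E) (old new : endpoint E -> endpoint E).
Hypotheses (oldK : cancel old new) (newK : cancel new old).

Let redraw_gap p := new (gap G (old p)).

Fact redraw_gapK : involutive redraw_gap.
Proof. by move=> p; rewrite /redraw_gap newK gapK oldK. Qed.

Fact redraw_gap_neq p : redraw_gap p != p.
Proof.
apply/eqP => /(congr1 old); rewrite /redraw_gap newK => /eqP.
by rewrite (negbTE (gap_neq G _)).
Qed.

Definition redraw := ArrowPresentation redraw_gapK redraw_gap_neq (bare G).
End Redraw.

Definition tau_old e p : endpoint E :=
  if (label p == e) && p.1.2 then other_end p else p.

Fact tau_oldK e : involutive (tau_old e).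
Proof.
case=> -[f i] h; rewrite /tau_old /label /other_end /=.
by case fe: (f == e); case: i; rewrite /= fe //= negbK.
Qed.

(** The half-twist: the arrow [(e, true)] is reversed. *)
Definition tau G e : arrow_presentation E :=
  redraw G (tau_oldK e) (tau_oldK e).

(** The new arrow [(e, i)] goes from the head of the old arrow [(e, i)] to the
    tail of the old arrow [(e, ~~ i)]. *)
Definition delta_old e p : endpoint E :=
  if label p == e then
    if p.2 then (label p, ~~ p.1.2, false) else (label p, p.1.2, true)
  else p.

Definition delta_new e p : endpoint E :=
  if label p == e then
    if p.2 then (label p, p.1.2, false) else (label p, ~~ p.1.2, true)
  else p.

Fact delta_oldK e : cancel (delta_old e) (delta_new e).
Proof.
case=> -[f i] h; rewrite /delta_old /delta_new /label /=.
by case fe: (f == e); case: i; case: h; rewrite /= fe.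
Qed.

Fact delta_newK e : cancel (delta_new e) (delta_old e).
Proof.
case=> -[f i] h; rewrite /delta_old /delta_new /label /=.
by case fe: (f == e); case: i; case: h; rewrite /= fe.
Qed.

(** The partial dual. *)
Definition delta G e : arrow_presentation E :=
  redraw G (@delta_oldK e) (@delta_newK e).

Definition circle_rel G : rel (endpoint E) :=
  fun p q => (q == gap G p) || (q == other_end p).

(** The circles of [G] whose arrows are all labelled [e] (and that carry at least
    one arrow); deleting [e] turns them into circles without arrows. *)
Definition num_circles_only G e : nat :=
  n_comp (circle_rel G)
    [pred p | [forall q, connect (circle_rel G) p q ==> (label q == e)]].

(** The far end of the gap starting at [p] (with [label p != e]) once the arrows
    labelled [e] are erased: at most two of them are crossed. *)
Definition bypass G e p : endpoint E :=
  let q := gap G p in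
  if label q != e then q else
  let r := gap G (other_end q) in
  if label r != e then r else gap G (other_end r).

Lemma other_endK : involutive (@other_end E).
Proof. by case=> -[f i] h; rewrite /other_end /= negbK. Qed.

Lemma other_end_neq p : other_end p != p.
Proof. by case: p => -[f i] h; rewrite /other_end !xpair_eqE !eqxx; case: h. Qed.

Lemma label_other_end p : label (other_end p) = label p.
Proof. by []. Qed.

Lemma gap_eq G p q : (gap G p == q) = (p == gap G q).
Proof. by rewrite (can2_eq (gapK G) (gapK G)). Qed.

Lemma endpoint_exhaust e p q r :
  label p = e -> label q = e -> label r = e -> q != p -> q != other_end p ->
  [|| r == p, r == other_end p, r == q | r == other_end q].
Proof.
case: p q r => -[f i] h [[f' i'] h'] [[f'' i''] h''].
rewrite /label /other_end /= => -> -> ->; rewrite !xpair_eqE !eqxx /=.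
by case: i; case: h; case: i'; case: h'; case: i''; case: h''.
Qed.

Lemma label_bypass G e p : label p != e -> label (bypass G e p) != e.
Proof.
move=> pNe; rewrite /bypass /=; case: ifPn => // /negPn/eqP qe.
case: ifPn => // /negPn/eqP re; apply/eqP => se.
set q := gap G p in qe re se *; set r := gap G (other_end q) in re se *.
have rq : r != q.
  rewrite /r gap_eq /q gapK; apply/eqP => pE.
  by move: pNe; rewrite -pE label_other_end qe eqxx.
have rq' : r != other_end q by apply: gap_neq.
have := endpoint_exhaust qe re se rq rq'.
rewrite (negbTE (gap_neq _ _)) orbF => /or3P[].
- rewrite gap_eq /q gapK => /eqP rE.
  by move: pNe; rewrite -rE label_other_end re eqxx.
- by rewrite gap_eq -/r (negbTE (other_end_neq _)).
- by rewrite gap_eq {2}/r gapK (inj_eq (inv_inj other_endK)) (negbTE rq).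
Qed.

Lemma bypassK G e p : label p != e -> bypass G e (bypass G e p) = p.
Proof.
move=> pNe; have := label_bypass G pNe; rewrite /bypass /=.
case: (boolP (label (gap G p) != e)) => [_ _|qe]; first by rewrite gapK pNe.
case: (boolP (label (gap G (other_end (gap G p))) != e)) => [_ _|re sNe].
  by rewrite gapK label_other_end (negbTE qe) other_endK gapK pNe.
by rewrite gapK label_other_end (negbTE re) other_endK gapK label_other_end
   (negbTE qe) other_endK gapK.
Qed.

Lemma bypass_neq G e p : bypass G e p != p.
Proof.
rewrite /bypass /=; case: ifPn => _; first exact: gap_neq.
case: ifPn => _; first by rewrite gap_eq other_end_neq.
by rewrite gap_eq (inv_eq other_endK) gap_neq.
Qed.

Section Deletion.
Variables (G : arrow_presentation E) (e : E).
Let E' : finType := {f : E | f != e}.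

Definition keep (p : endpoint E') : endpoint E := (val p.1.1, p.1.2, p.2).

(** The default value of [insubd] is never used, by [label_bypass]. *)
Definition delete_gap (p : endpoint E') : endpoint E' :=
  let q := bypass G e (keep p) in (insubd p.1.1 q.1.1, q.1.2, q.2).

Lemma keep_inj : injective keep.
Proof.
by move=> [[f i] h] [[f' i'] h'] [] /= /val_inj -> -> ->.
Qed.

Lemma keep_delete_gap (p : endpoint E') : keep (delete_gap p) = bypass G e (keep p).
Proof.
have := @label_bypass G e (keep p) (valP p.1.1); rewrite /keep /delete_gap /label.
case: (bypass _ _ _) => -[f i] h /= fe.
by rewrite insubdK.
Qed.

Fact delete_gapK : involutive delete_gap.
Proof.
move=> p; apply: keep_inj; rewrite !keep_delete_gap bypassK //.
exact: (valP p.1.1).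
Qed.

Fact delete_gap_neq (p : endpoint E') : delete_gap p != p.
Proof. by rewrite -(inj_eq keep_inj) keep_delete_gap bypass_neq. Qed.

(** The graph [G - e], with edge set [E \ {e}]. *)
Definition delete : arrow_presentation {f : E | f != e} :=
  ArrowPresentation delete_gapK delete_gap_neq (bare G + num_circles_only G e).
End Deletion.

End Operations.

Definition contract (E : finType) (G : arrow_presentation E) (e : E) :=
  delete (delta G e) e.

(** * The Penrose polynomial *)

Inductive vertex_state := WhiteSplit | BlackSplit | Crossing.

Definition vertex_state_code (x : vertex_state) : option bool :=
  match x with
  | WhiteSplit => Some true | BlackSplit => Some false | Crossing => None
  end.
Definition vertex_state_decode (x : option bool) : vertex_state :=
  match x with
  | Some true => WhiteSplit | Some false => BlackSplit | None => Crossing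
  end.
Fact vertex_state_codeK : cancel vertex_state_code vertex_state_decode.
Proof. by case. Qed.

HB.instance Definition _ :=
  Finite.copy vertex_state (can_type vertex_state_codeK).

Section Penrose.
Variable E : finType.
Implicit Types (G : arrow_presentation E) (p q : endpoint E).

(** The medial graph.  It has one vertex v_e in each edge disc e.  A face boundary
    of [G] runs alternately along sides of edge discs and along gaps, so the edges
    of the medial graph correspond to the gaps; the half-edge of that edge at v_e
    is identified with the endpoint of the gap, which is a corner of the disc e.
    Hence the half-edges at v_e are the four endpoints labelled [e], and
    [gap G] matches the two half-edges of a medial edge.  An isolated vertex of
    [G] contributes a vertex-free closed curve.

    As both arrows agree with an orientation of the boundary of the disc e, the
    cyclic order of the half-edges at v_e is
      (e, false, false), (e, false, true), (e, true, false), (e, true, true).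
    Two half-edges at the ends of the same arrow bound a corner at a vertex of
    [G], i.e. a black corner; two half-edges on the same side of the disc e (from
    the head of an arrow to the tail of the other) bound a white corner. *)
Definition split_mate (x : vertex_state) p : endpoint E :=
  match x with
  | BlackSplit => (p.1.1, p.1.2, ~~ p.2)
  | WhiteSplit => (p.1.1, ~~ p.1.2, ~~ p.2)
  | Crossing => (p.1.1, ~~ p.1.2, p.2)
  end.

Definition state : finType := {ffun E -> vertex_state}.
Implicit Type s : state.

Definition penrose_state s : bool := [forall e, s e != BlackSplit].

Definition cr s : nat := #|[set e | s e == Crossing]|.

Definition curve_rel G s : rel (endpoint E) :=
  fun p q => (q == gap G p) || (q == split_mate (s (label p)) p).

Definition num_curves G s : nat := (n_comp (curve_rel G s) predT + bare G)%N.

Definition penrose G : {poly int} :=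
  \sum_(s : state | penrose_state s) (-1) ^+ cr s *: 'X^(num_curves G s).

End Penrose.

(* Main.v *)
(** Let [m] be the pairing of the four endpoints labelled [e] given by a vertex
    state at [e].  Following the curves of a state of [G] through [m] is the same
    as erasing the arrows labelled [e] in the arrow presentation obtained from [G]
    by redrawing these arrows along the pairs of [m].  The black split, white split
    and crossing at [e] thus yield the curves of the states of [G - e], [G / e] and
    [G^tau(e) / e], and [delta] exchanges the black and white splits at [e] while
    [tau] exchanges the white split and the crossing.  The three identities follow
    by splitting the state sum according to the state at [e]. *)

Require Import Defs.
From mathcomp Require Import all_boot all_order all_algebra.

Set Implicit Arguments.
Unset Strict Implicit.
Unset Printing Implicit Defensive.

Import GRing.Theory.
Local Open Scope ring_scope.

(** * Reachability in finite relations *)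

Lemma connect_ind (T : finType) (r : rel T) (P : T -> Prop) (x : T) :
  P x -> (forall y z, r y z -> P y -> P z) -> forall y, connect r x y -> P y.
Proof.
move=> Px rP _ /connectP[p + ->].
elim: p x Px => //= y p IHp x Px /andP[rxy]; apply: IHp; exact: rP Px.
Qed.

(** Each [r']-step from a point that [r] reaches starts in [A], so it is also an [r]-step; induction
    along the path then keeps it within reach of [r]. *)
Lemma eq_connect_in (T : finType) (A : {pred T}) (r r' : rel T) (x : T) :
    {in A, forall y, r y =1 r' y} -> (forall y, connect r x y -> y \in A) ->
  connect r x =1 connect r' x.
Proof.
move=> eqrr' rA y; apply/idP/idP => [|r'xy].
  suff H z : connect r x z -> connect r x z /\ connect r' x z by case/H.
  apply: (connect_ind (P := fun z => connect r x z /\ connect r' x z)).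
    by rewrite !connect0.
  move=> {}y {}z ryz [rxy r'xy]; have rxz := connect_trans rxy (connect1 ryz).
  split=> //; apply: connect_trans r'xy _.
  by rewrite connect1 // -eqrr' ?rA.
apply: (connect_ind (P := fun z => connect r x z)) r'xy; first exact: connect0.
move=> {}y z r'yz rxy; apply: connect_trans (rxy) _.
by rewrite connect1 // eqrr' ?rA.
Qed.

(** * Splitting the state sum at one edge *)

Section StateExtension.
Variables (E : finType) (e : E).
Implicit Types (s : state {f : E | f != e}) (x : vertex_state).
Implicit Type G : arrow_presentation E.

Definition extend s x : state E := [ffun f => oapp s x (insub f)].

Lemma extend_at s x : extend s x e = x.
Proof. by rewrite ffunE insubN ?eqxx. Qed.

Lemma extend_val s x f : extend s x (val f) = s f.
Proof. by rewrite ffunE valK. Qed.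

Lemma penrose_extend s x :
  penrose_state (extend s x) = (x != BlackSplit) && penrose_state s.
Proof.
apply/forallP/andP => [sP | [xNb /forallP sP] f].
  split; first by rewrite -(extend_at s x).
  by apply/forallP => f; rewrite -(extend_val s x).
by rewrite ffunE; case: insubP => [u _ _|_] /=.
Qed.

Lemma cr_extend s x : cr (extend s x) = ((x == Crossing) + cr s)%N.
Proof.
rewrite /cr (cardsD1 e) inE extend_at; congr (_ + _)%N.
rewrite -(card_imset _ val_inj); apply: eq_card => f; rewrite !inE.
apply/andP/imsetP => [[fNe] | [u + ->]].
  by rewrite -[f]/(val (Sub f fNe : {f | f != e})) extend_val => fC;
    exists (Sub f fNe); rewrite ?inE.
by rewrite inE extend_val => ->; split=> //; apply: (valP u).
Qed.

(** Extension by [x] and restriction to the other edges are inverse bijections; as [x] is not black,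
    they preserve Penrose states. *)
Lemma sum_extend (R : nmodType) (F : state E -> R) x : x != BlackSplit ->
  \sum_(s | penrose_state s && (s e == x)) F s
    = \sum_(s | penrose_state s) F (extend s x).
Proof.
move=> xNb; pose restrict (t : state E) : state {f : E | f != e} :=
  [ffun f => t (val f)].
rewrite (reindex_onto (extend^~ x) restrict) => [|t /andP[_ /eqP te]].
  apply: eq_bigl => s; rewrite penrose_extend xNb extend_at eqxx andbT.
  rewrite andbC; case: eqP => // -[].
  by apply/ffunP => f; rewrite ffunE extend_val.
apply/ffunP => f; rewrite ffunE; case: insubP => [u _ <-|/negPn/eqP->] //=.
by rewrite ffunE.
Qed.

(** The sign ignores [x], even if [x] is [Crossing]. *)
Definition state_sum G x : {poly int} :=
  \sum_(s | penrose_state s) (-1) ^+ cr s *: 'X^(num_curves G (extend s x)).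

Lemma penrose_split G :
  penrose G = state_sum G WhiteSplit - state_sum G Crossing.
Proof.
rewrite /penrose (bigID (fun s : state E => s e == WhiteSplit)) /=.
rewrite sum_extend // /state_sum -sumrN; congr (_ + _).
  by apply: eq_bigr => s _; rewrite cr_extend.
rewrite (eq_bigl (fun t => penrose_state t && (t e == Crossing))) => [|t].
  rewrite sum_extend //; apply: eq_bigr => s _.
  by rewrite cr_extend exprS mulN1r scaleNr.
case: (boolP (penrose_state t)) => //= /forallP/(_ e).
by case: (t e).
Qed.

End StateExtension.

Arguments extend [E] e s x.
Arguments state_sum [E] e G x.

(** * Curves of a state under redrawing *)

Section Curves.
Variable E : finType.
Implicit Types (G : arrow_presentation E) (s : state E) (p q : endpoint E).

Lemma split_mateK x : involutive (@split_mate E x).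
Proof. by case: x => -[[f i] h] /=; rewrite ?negbK. Qed.

Lemma label_split_mate x p : label (split_mate x p) = label p.
Proof. by case: x. Qed.

Lemma curve_rel_sym G s : symmetric (curve_rel G s).
Proof.
have half p q : curve_rel G s p q -> curve_rel G s q p.
  by case/orP=> /eqP ->; rewrite /curve_rel ?label_split_mate ?gapK ?split_mateK
    eqxx ?orbT.
by move=> p q; apply/idP/idP; apply: half.
Qed.

Lemma connect_gap G s p : connect (curve_rel G s) p (gap G p).
Proof. by rewrite connect1 /curve_rel ?eqxx. Qed.

Lemma connect_mate G s p :
  connect (curve_rel G s) p (split_mate (s (label p)) p).
Proof. by rewrite connect1 /curve_rel ?eqxx ?orbT. Qed.

(** The bijection [old] carries gaps to gaps by construction and mates to mates by hypothesis, so it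
    is an isomorphism of curve relations. *)
Lemma num_curves_redraw G (old new : endpoint E -> endpoint E)
    (oldK : cancel old new) (newK : cancel new old) s s' :
    (forall p, old (split_mate (s (label p)) p)
               = split_mate (s' (label (old p))) (old p)) ->
  num_curves (redraw G oldK newK) s = num_curves G s'.
Proof.
move=> old_mate; have sym G' t := sym_connect_sym (@curve_rel_sym G' t).
rewrite /num_curves.
suff -> : n_comp (curve_rel G s') predT
          = n_comp (curve_rel (redraw G oldK newK) s) predT by [].
apply: (adjunction_n_comp old (sym _ _) (sym _ _)) => //.
apply: strict_adjunction => //.
- exact: can_inj oldK.
- by apply/subsetP => p _; rewrite -(newK p) codom_f.
move=> p q _; rewrite /curve_rel /= -old_mate (inj_eq (can_inj oldK)).
by rewrite (can2_eq oldK newK).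
Qed.

End Curves.

(** * Deleting an edge as a black split *)

Section DeletionCurves.
Variables (E : finType) (H : arrow_presentation E) (e : E).
Variable s : state {f : E | f != e}.
Implicit Types (p q : endpoint E) (u v : endpoint {f : E | f != e}).

Let black := extend e s BlackSplit.
Let r := curve_rel H black.
Let r' := curve_rel (delete H e) s.

Let r_sym : connect_sym r.
Proof. exact/sym_connect_sym/curve_rel_sym. Qed.

Let mate_black p : label p = e -> split_mate (black (label p)) p = other_end p.
Proof. by move->; rewrite /black extend_at. Qed.

Let keep_mate u :
  keep (split_mate (s (label u)) u)
    = split_mate (black (label (keep u))) (keep u).
Proof. by rewrite /black /label /= extend_val; case: (s _). Qed.

Let keepP p : label p != e -> exists u, p = keep u.
Proof.
by case: p => -[f i] h /= fe; exists ((Sub f fe : {f | f != e}), i, h).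
Qed.

Let connect_other p : label p = e -> connect r p (other_end p).
Proof. by move/mate_black <-; apply: connect_mate. Qed.

Lemma connect_bypass p : connect r p (bypass H e p).
Proof.
rewrite /bypass /=; case: ifPn => [_|/negPn/eqP qe]; first exact: connect_gap.
apply: connect_trans (connect_gap _ _ _) _.
apply: connect_trans (connect_other qe) _.
case: ifPn => [_|/negPn/eqP re]; first exact: connect_gap.
apply: connect_trans (connect_gap _ _ _) _.
apply: connect_trans (connect_other re) _.
exact: connect_gap.
Qed.

(** [p] lies on the path of gaps and arrows labelled [e] that [bypass] follows
    from [q]. *)
Let on_bypass q p : Prop :=
  let q1 := gap H q in let q2 := gap H (other_end q1) in
  [\/ p = q, label q1 = e /\ (p = q1 \/ p = other_end q1)
    | [/\ label q1 = e, label q2 = e & p = q2 \/ p = other_end q2]].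

(** Invariant for following a curve of [H] from [keep u]: the current endpoint lies on the erased
    path issuing from a surviving endpoint on the curve of [u]. *)
Let reached u p : Prop := exists2 v, connect r' u v & on_bypass (keep v) p.

(** A step moves along the bypass path, or leaves it: by the gap at its far end, reaching
    [keep (delete_gap H v)], or by the mate of [keep v]. *)
Let reached_step u p q : r p q -> reached u p -> reached u q.
Proof.
move=> rpq [v uv vp].
have keep_gap : keep (delete_gap H v) = bypass H e (keep v).
  exact: keep_delete_gap.
have to_gap : reached u (bypass H e (keep v)).
  exists (delete_gap H v); last exact: Or31.
  exact: connect_trans uv (connect_gap (delete H e) _ _).
have to_v p' : on_bypass (keep v) p' -> reached u p' by exists v.
move: to_gap; rewrite /bypass /=.
case: vp => [pE|[ve pE]|[ve we pE]].
- case/orP: rpq => /eqP ->.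
    case: ifPn => [_|/negPn/eqP ve _]; rewrite pE //.
    by apply: to_v; apply: Or32; split=> //; left.
  move=> _; exists (split_mate (s (label v)) v).
    exact: connect_trans uv (connect_mate _ _ _).
  by rewrite pE -keep_mate; apply: Or31.
- rewrite ve eqxx /=.
  case/orP: rpq => /eqP ->; case: pE => ->; rewrite ?gapK ?mate_black //.
  + by move=> _; apply: to_v; apply: Or31.
  + case: ifPn => [//|/negPn/eqP we _].
    by apply: to_v; apply: Or33; split=> //; left.
  + by move=> _; apply: to_v; apply: Or32; split=> //; right.
  + by move=> _; apply: to_v; apply: Or32; rewrite other_endK; split=> //; left.
- rewrite ve we eqxx /=.
  case/orP: rpq => /eqP ->; case: pE => ->; rewrite ?gapK ?mate_black //.
  + by move=> _; apply: to_v; apply: Or32; split=> //; right.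
  + by move=> _; apply: to_v; apply: Or33; split=> //; right.
  + by move=> _; apply: to_v; apply: Or33; rewrite other_endK; split=> //; left.
Qed.

(** Forwards, the inner points of a bypass path are labelled [e], so a surviving endpoint on it is
    its start or would contradict its label. Backwards, each new gap is a path of [r]. *)
Lemma connect_keep u v : connect r (keep u) (keep v) = connect r' u v.
Proof.
apply/idP/idP => [uv|].
  have [w uw] : reached u (keep v).
    apply: (connect_ind (P := reached u)) uv; last exact: reached_step.
    by exists u => //; apply: Or31.
  have vNe : label (keep v) != e by apply: (valP v.1.1).
  case=> [/keep_inj->//|[we vE]|[_ we vE]];
    by move: vNe; case: vE => ->; rewrite ?label_other_end we eqxx.
apply: (connect_ind (P := fun w => connect r (keep u) (keep w))) => //.
move=> w w' ww' uw; apply: connect_trans uw _.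
case/orP: ww' => /eqP ->; last by rewrite keep_mate connect_mate.
by rewrite /= keep_delete_gap connect_bypass.
Qed.

Let only_e p := [forall q, connect r p q ==> (label q == e)].

Let only_e_closed : closed r only_e.
Proof.
apply: (intro_closed r_sym) => p q rpq /forallP pe; apply/forallP => q'.
by rewrite -(same_connect1 r_sym rpq).
Qed.

(** At endpoints labelled [e] the black split follows the arrow, so [r] and [circle_rel H] agree
    along these components. *)
Lemma n_comp_only_e : n_comp r only_e = num_circles_only H e.
Proof.
have circle_r p : label p = e -> r p =1 circle_rel H p.
  by move=> pe q; rewrite /r /curve_rel mate_black.
have only_e_circle p :
    only_e p = [forall q, connect (circle_rel H) p q ==> (label q == e)].
  apply/forallP/forallP => pe q; move: (pe q).
    rewrite -(@eq_connect_in _ [pred q | label q == e] r) // => [q' /eqP|q' pq'].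
      exact: circle_r.
    by have := pe q'; rewrite pq'.
  rewrite (@eq_connect_in _ [pred q | label q == e] _ r) // => [q' /eqP|q' pq'].
    by move=> q'e x; rewrite circle_r.
  by have := pe q'; rewrite pq'.
apply: eq_card => p; rewrite !inE -[_ \in only_e]/(only_e p) -only_e_circle.
case: (boolP (only_e p)) => [/forallP pe|]; last by rewrite !andbF.
(* A root is picked from the connectivity predicate, so equal predicates give equal roots. *)
rewrite !andbT; congr (_ == p); congr (odflt p _); apply: eq_pick.
apply: (@eq_connect_in _ [pred q | label q == e]) => [q /eqP|q pq].
  exact: circle_r.
by have := pe q; rewrite pq.
Qed.

(** Curves meeting only [e] become bare circles; every other curve contains a surviving endpoint,
    and [keep] matches it with a curve of [delete H e]. *)
Lemma num_curves_delete : num_curves (delete H e) s = num_curves H black.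
Proof.
rewrite /num_curves /= -/r -/r' (n_compC only_e r) n_comp_only_e.
rewrite addnCA addnC; congr (_ + _)%N; rewrite addnC; congr (_ + _)%N.
have r'_sym : connect_sym r' by apply/sym_connect_sym/curve_rel_sym.
have keepN u : ~~ only_e (keep u).
  apply/forallPn; exists (keep u); rewrite connect0 /=; exact: (valP u.1.1).
have cl := predC_closed only_e_closed.
rewrite (adjunction_n_comp (@keep E e) r_sym r'_sym cl).
  by apply: eq_n_comp_r => u; rewrite !inE [in RHS]keepN.
split=> [p pN|u v _]; last by rewrite connect_keep.
(* The adjunction asks for an explicit witness, which [sigW] extracts from bare existence. *)
apply: sigW; move: pN => /forallPn[q]; rewrite negb_imply => /andP[pq qNe].
by have [u qE] := keepP qNe; exists u; rewrite -qE.
Qed.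

End DeletionCurves.

(** * Action of partial duality and half-twist on vertex states *)

Section RedrawnCurves.
Variables (E : finType) (e : E).
Implicit Types (s : state {f : E | f != e}) (x : vertex_state).
Implicit Type G : arrow_presentation E.

Definition delta_state x :=
  match x with
  | WhiteSplit => BlackSplit | BlackSplit => WhiteSplit | Crossing => Crossing
  end.

Definition tau_state x :=
  match x with
  | WhiteSplit => Crossing | BlackSplit => BlackSplit | Crossing => WhiteSplit
  end.

(** [delta_old] rotates the four half-edges at [e] by one place, swapping the two pairings of
    neighbours and fixing the pairing of opposites. *)
Lemma num_curves_delta G s x :
  num_curves (delta G e) (extend e s x)
    = num_curves G (extend e s (delta_state x)).
Proof.
apply: num_curves_redraw => -[[f i] h].
case: (eqVneq f e) => [->|fNe].
  rewrite /delta_old /label /= extend_at.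
  by case: x; case: i; case: h; rewrite /= eqxx /= extend_at.
rewrite /delta_old label_split_mate /label /= (negbTE fNe) /=.
by rewrite -[f]/(val (Sub f fNe : {f | f != e})) !extend_val.
Qed.

(** [tau_old] swaps the two ends of one arrow, which keeps the black pairing and exchanges the other
    two. *)
Lemma num_curves_tau G s x :
  num_curves (tau G e) (extend e s x) = num_curves G (extend e s (tau_state x)).
Proof.
apply: num_curves_redraw => -[[f i] h].
case: (eqVneq f e) => [->|fNe].
  rewrite /tau_old /label /= extend_at.
  by case: x; case: i; case: h; rewrite /= eqxx /= extend_at.
rewrite /tau_old label_split_mate /label /= (negbTE fNe) /=.
by rewrite -[f]/(val (Sub f fNe : {f | f != e})) !extend_val.
Qed.

Lemma state_sum_delta G x :
  state_sum e (delta G e) x = state_sum e G (delta_state x).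
Proof. by apply: eq_bigr => s _; rewrite num_curves_delta. Qed.

Lemma state_sum_tau G x : state_sum e (tau G e) x = state_sum e G (tau_state x).
Proof. by apply: eq_bigr => s _; rewrite num_curves_tau. Qed.

Lemma penrose_delete G : penrose (delete G e) = state_sum e G BlackSplit.
Proof. by apply: eq_bigr => s _; rewrite num_curves_delete. Qed.

Lemma penrose_contract G : penrose (contract G e) = state_sum e G WhiteSplit.
Proof. by rewrite penrose_delete state_sum_delta. Qed.

End RedrawnCurves.

Theorem theorem5p6 (E : finType) (G : arrow_presentation E) (e : E) :
  [/\ penrose G = penrose (contract G e) - penrose (contract (tau G e) e),
      penrose G = penrose (contract G e)
                  - penrose (contract (tau (delta G e) e) e)
    & penrose (delta (tau G e) e)
        = penrose (delete G e) - penrose (contract G e)].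
Proof.
split.
- by rewrite (penrose_split e) !penrose_contract state_sum_tau.
(* The twist turns white into the crossing, which [delta] fixes. *)
- by rewrite (penrose_split e) !penrose_contract state_sum_tau state_sum_delta.
(* Through [delta_state] and then [tau_state], white becomes black and the crossing becomes
   white. *)
rewrite (penrose_split e) penrose_contract penrose_delete.
by rewrite !state_sum_delta !state_sum_tau.
Qed.
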